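(* Let $\mathcal S=(\gamma_1,\gamma_2)$ be a pair of weighted density operators on a finite-dimensional complex Hilbert space $\mathscr H$. Then there exists exactly one optimal and proper USD measurement of $\mathcal S$.
   Context: A weighted density operator is a positive semi-definite operator on $\mathscr H$ (no normalization of the trace is required). For a positive semi-definite operator $\rho$, $\operatorname{supp}\rho=(\ker\rho)^\perp$. For $\mathcal S=(\gamma_1,\gamma_2)$ put $\operatorname{supp}\mathcal S=\operatorname{supp}(\gamma_1+\gamma_2)=\operatorname{supp}\gamma_1+\operatorname{supp}\gamma_2$. A USD (unambiguous state discrimination) measurement of $\mathcal S$ is a triple $\mathcal E=(E_1,E_2,E_?)$ of positive semi-definite operators on $\mathscr H$ with $E_1+E_2+E_?=1$ (identity), $\operatorname{tr}(E_2\gamma_1)=0$ and $\operatorname{tr}(E_1\gamma_2)=0$. Its success probability is $P_{\mathrm{succ}}(\mathcal E;\mathcal S)=\operatorname{tr}(E_1\gamma_1)+\operatorname{tr}(E_2\gamma_2)$. It is optimal if its success probability is maximal among all USD measurements of $\mathcal S$, and proper if $\operatorname{supp}(E_1+E_2)\subseteq\operatorname{supp}\mathcal S$. *)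

(* Defs.v *)
From HB Require Import structures.
From mathcomp Require Import all_boot all_order all_algebra.
From mathcomp Require Import reals.
From mathcomp Require Import complex.

Set Implicit Arguments.
Unset Strict Implicit.
Unset Printing Implicit Defensive.

Import Order.TTheory GRing.Theory Num.Theory.
Local Open Scope ring_scope.

(* A finite-dimensional complex Hilbert space is a finite-dimensional vector
   space [H] over [R[i]], [R] being the field of real numbers, together with a
   positive definite Hermitian form [dot] (completeness is automatic).  The form
   is linear in its first argument and conjugate-linear in the second. *)

(* The trace does not depend on the basis; any would do. *)
Definition lftrace (K : fieldType) (V : vectType K) (A : 'End(V)) : K :=
  \tr (passmx.mxof (vbasis {:V}) (vbasis {:V}) A).

Section Operators.
Variables (R : realType) (H : vectType R[i]).
Variable dot : {dot H for Num.conj}.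

(* In the order of [R[i]], [0 <= z] means that [z] is real and nonnegative;
   such an operator is therefore self-adjoint. *)
Definition psd (A : 'End(H)) : Prop := forall u : H, 0 <= dot (A u) u.

Definition supp (A : 'End(H)) : {vspace H} := orthov dot (lker A).

End Operators.

Record measurement (R : realType) (H : vectType R[i]) := Measurement {
  E_1 : 'End(H);
  E_2 : 'End(H);
  E_inconclusive : 'End(H)
}.

Section Discrimination.
Variables (R : realType) (H : vectType R[i]).
Variable dot : {dot H for Num.conj}.
Variables gamma1 gamma2 : 'End(H).
Implicit Type E : measurement H.

Definition supp_pair : {vspace H} := supp dot (gamma1 + gamma2).

Definition is_usd E : Prop :=
  [/\ [/\ psd dot (E_1 E), psd dot (E_2 E) & psd dot (E_inconclusive E)],
      E_1 E + E_2 E + E_inconclusive E = \1%VF,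
      lftrace (E_2 E \o gamma1)%VF = 0
    & lftrace (E_1 E \o gamma2)%VF = 0].

(* This complex number is real when the operators involved are positive
   semi-definite. *)
Definition success_prob E : R[i] :=
  lftrace (E_1 E \o gamma1)%VF + lftrace (E_2 E \o gamma2)%VF.

Definition optimal_usd E : Prop :=
  forall F, is_usd F -> success_prob F <= success_prob E.

Definition proper_usd E : Prop := (supp dot (E_1 E + E_2 E)%R <= supp_pair)%VS.

End Discrimination.

(* Main.v *)
(* Existence: USD measurements form a compact set on which the success
   probability is linear, and compressing an optimal measurement by the projection
   onto the support of [gamma1 + gamma2] makes it proper without changing the
   success probability.

   Uniqueness: let [E] and [F] be optimal and proper, let [M] be their midpoint,
   and put [D1 = E_1 E - E_1 F], [D2 = E_2 E - E_2 F].  The ranges of [D1] and [D2]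
   lie in [ker gamma2] and [ker gamma1], which on the support of the pair meet only
   in [0]; hence the kernel of [D1 + D2] is contained in that of [D1].  As
   [D1 + D2] vanishes on the kernel of the inconclusive operator of [M], the range
   of [D1] is contained in the range of that operator.  Were some [a = D1 x]
   nonzero, a small multiple of [|a><a|] could be moved from the inconclusive
   operator of [M] to its first operator, which increases the success probability
   because [<gamma1 a, a>] is positive. *)

From HB Require Import structures.
Require Import Defs.
From mathcomp Require Import all_boot all_order all_algebra.
From mathcomp Require Import reals.
From mathcomp Require Import complex ring.
From mathcomp Require Import classical_sets boolp topology normedtype derive.

Set Implicit Arguments.
Unset Strict Implicit.
Unset Printing Implicit Defensive.

Import Order.TTheory GRing.Theory Num.Theory.
Import numFieldNormedType.Exports.
Local Open Scope ring_scope.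

(** * The sesquilinear form, rank-one operators and Cauchy-Schwarz for positive operators *)

Section DotBasics.
Variables (R : realType) (H : vectType R[i]) (dot : {dot H for Num.conj}).
Implicit Types (a b u v w : H) (A B : 'End(H)) (c : R[i]).

Lemma dotDl u v w : dot (u + v) w = dot u w + dot v w.
Proof. exact: linearDl. Qed.

Lemma dotDr u v w : dot u (v + w) = dot u v + dot u w.
Proof. exact: linearDr. Qed.

Lemma dotBl u v w : dot (u - v) w = dot u w - dot v w.
Proof. exact: linearBl. Qed.

Lemma dotBr u v w : dot u (v - w) = dot u v - dot u w.
Proof. exact: linearBr. Qed.

Lemma dotZl c u v : dot (c *: u) v = c * dot u v.
Proof. exact: linearZl_LR. Qed.

Lemma dotZr c u v : dot u (c *: v) = c^* * dot u v.
Proof. exact: linearZr_LR. Qed.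

Lemma dotC u v : dot u v = (dot v u)^*.
Proof. by rewrite [LHS]hermC /= expr0 mul1r. Qed.

Lemma dot0l u : dot 0 u = 0.
Proof. exact: linear0l. Qed.

Lemma dot0r u : dot u 0 = 0.
Proof. exact: linear0r. Qed.

Lemma dot_suml I (r : seq I) (P : pred I) (F : I -> H) w :
  dot (\sum_(i <- r | P i) F i) w = \sum_(i <- r | P i) dot (F i) w.
Proof. exact: linear_sumlz. Qed.

Lemma dot_nondeg u : (forall v, dot u v = 0) -> u = 0.
Proof. by move=> h; apply/eqP; rewrite -(dnorm_eq0 dot) h. Qed.

Definition ketbra_fun a b u := dot u b *: a.

Fact ketbra_fun_linear a b : linear (ketbra_fun a b).
Proof. by move=> c u v; rewrite /ketbra_fun dotDl dotZl scalerDl scalerA. Qed.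

HB.instance Definition _ a b :=
  GRing.isLinear.Build _ _ _ _ (ketbra_fun a b) (ketbra_fun_linear a b).

Definition ketbra a b : 'End(H) := linfun (ketbra_fun a b).

Lemma ketbraE a b u : ketbra a b u = dot u b *: a.
Proof. by rewrite lfunE. Qed.

(** Polarization: the defect [s] is sesquilinear and vanishes on the diagonal, because [dot (A w) w]
    is real. Expanding it at [u + c *: v] with [c = 'i] and [c = 1] gives [s u v = s v u] and
    [s u v = - s v u]. *)
Lemma psd_sym A u v : psd dot A -> dot (A u) v = dot u (A v).
Proof.
move=> Apsd; pose s x y := dot (A x) y - dot x (A y).
have s0 w : s w w = 0.
  by apply/eqP; rewrite subr_eq0 [X in _ == X]dotC eq_sym conj_Creal ?ger0_real.
have sE c : c^* * s u v + c * s v u = 0.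
  suff : s (u + c *: v) (u + c *: v) =
    s u u + c * c^* * s v v + (c^* * s u v + c * s v u).
    by rewrite !s0 mulr0 !add0r.
  have AE : A (u + c *: v) = A u + c *: A v by rewrite linearD linearZ.
  rewrite /s AE !(dotDl, dotDr, dotZl, dotZr); ring.
have vuE : s v u = s u v.
  have := sE 'i; rewrite conjCi mulNr addrC -mulrBr => /eqP.
  by rewrite mulf_eq0 (negPf (neq0Ci _)) subr_eq0 => /eqP.
have := sE 1; rewrite conjC1 !mul1r vuE -mulr2n => /eqP.
by rewrite mulrn_eq0 /= subr_eq0 => /eqP.
Qed.

Lemma psd_CauchySchwarz A u v : psd dot A ->
  `|dot (A u) v| ^+ 2 <= dot (A u) u * dot (A v) v.
Proof.
move=> Apsd; rewrite normCK.
set p := dot (A u) u; set q := dot (A v) v; set b := dot (A u) v.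
have bC : dot (A v) u = b^* by rewrite psd_sym // dotC.
have p0 : 0 <= p by exact: Apsd.
have q0 : 0 <= q by exact: Apsd.
have expand (x y : R[i]) : dot (A (x *: u - y *: v)) (x *: u - y *: v) =
    x * x^* * p - x * y^* * b - y * x^* * b^* + y * y^* * q.
  have -> : A (x *: u - y *: v) = x *: A u - y *: A v by rewrite linearB !linearZ.
  rewrite !(dotBl, dotBr, dotZl, dotZr) bC -/p -/q -/b.
  ring.
have [qE|qN0] := eqVneq q 0; last first.
  have qgt : 0 < q by rewrite lt_def qN0.
  have := Apsd (q *: u - b *: v); rewrite expand (conj_Creal (ger0_real q0)).
  have -> : q * q * p - q * b^* * b - b * q * b^* + b * b^* * q = q * (p * q - b * b^*).
    ring.
  by rewrite pmulr_rge0 // subr_ge0.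
have [->|bN0] := eqVneq b 0; first by rewrite mul0r mulr_ge0.
have bb : b * b^* != 0 by rewrite -normCK expf_neq0 // normr_eq0.
(* When [q = 0] and [b != 0], this [t] gives the form the negative value [- p - 2] at
   [u - (t * b) *: v]. *)
pose t := (p + 1) / (b * b^*).
have tC : t^* = t.
  by apply: conj_Creal; rewrite ger0_real // divr_ge0 ?addr_ge0 // -normCK exprn_ge0.
have := Apsd (1 *: u - (t * b) *: v); rewrite expand qE conjC1 rmorphM /= tC.
have -> : 1 * 1 * p - 1 * (t * b^*) * b - t * b * 1 * b^* + t * b * (t * b^*) * 0
   = - p - 2.
  rewrite /t; field; apply/andP; split; [rewrite conjC_eq0|]; exact: bN0.
move=> /(addr_ge0 p0); rewrite addrA subrr add0r oppr_ge0 => two_le0.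
by have := lt_le_trans (ltr0n R[i] 2) two_le0; rewrite ltxx.
Qed.

Lemma psd_eq0 A u : psd dot A -> dot (A u) u = 0 -> A u = 0.
Proof.
move=> Apsd Au0; apply/eqP; rewrite -(dnorm_eq0 dot).
have := psd_CauchySchwarz u (A u) Apsd.
by rewrite Au0 mul0r -normrX normr_le0 expf_eq0.
Qed.

End DotBasics.

(** * Trace and rank of endomorphisms *)

Section Trace.
Variables (K : fieldType) (V : vectType K).
Implicit Types A B : 'End(V).

Lemma lftraceD A B : lftrace (A + B) = lftrace A + lftrace B.
Proof.
by rewrite -[A]scale1r /lftrace passmx.mxof_linear scale1r mxtraceD !scale1r.
Qed.

Lemma lftrace0 : lftrace (0 : 'End(V)) = 0.
Proof.
rewrite /lftrace; set M := passmx.mxof _ _ _.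
by have -> : M = 0; [apply/eqP; rewrite passmx.mxof_eq0 ?vbasisP | exact: mxtrace0].
Qed.

Lemma lftraceZ (c : K) A : lftrace (c *: A) = c * lftrace A.
Proof.
rewrite -[LHS]addr0 -lftrace0 -lftraceD /lftrace passmx.mxof_linear mxtraceD mxtraceZ.
by rewrite -[X in _ + X]/(lftrace 0) lftrace0 addr0.
Qed.

Lemma lftraceC A B : lftrace (A \o B)%VF = lftrace (B \o A)%VF.
Proof.
by rewrite /lftrace !(passmx.mxof_comp _ _ (vbasisP fullv)) mxtrace_mulC.
Qed.

(** The codimension of the kernel is the rank; it is the measure that decreases when a rank-one
    piece is split off. *)
Lemma ltn_codim_lker A B v : (forall u, A u = 0 -> B u = 0) -> A v != 0 ->
  B v = 0 -> (\dim {:V} - \dim (lker B) < \dim {:V} - \dim (lker A))%N.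
Proof.
move=> sAB Av Bv; apply: ltn_sub2l.
  rewrite (ltn_leqif (dimv_leqif_eq (subvf _))); apply: contra Av => /eqP ke.
  by rewrite -memv_ker ke memvf.
have sub : (lker A <= lker B)%VS.
  by apply/subvP => u; rewrite !memv_ker => /eqP /sAB ->.
rewrite (ltn_leqif (dimv_leqif_eq sub)); apply: contra Av => /eqP ke.
by rewrite -memv_ker ke memv_ker Bv.
Qed.

End Trace.

(** * Traces of products of positive operators *)

Section PositiveOperators.
Variables (R : realType) (H : vectType R[i]) (dot : {dot H for Num.conj}).
Implicit Types (a b u v w : H) (A B : 'End(H)) (c : R[i]).

(** The diagonal entries are the coordinates of [a] times the values [dot b_i b] at the basis
    vectors, and these sum to [dot a b]. *)
Lemma lftrace_ketbra a b : lftrace (ketbra dot a b) = dot a b.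
Proof.
rewrite /lftrace /mxtrace [in RHS](coord_vbasis (memvf a)) dot_suml.
apply: eq_bigr => i _; rewrite !mxE /= passmx.vecof_delta ketbraE linearZ /=.
by rewrite dotZl mulrC.
Qed.

Lemma sub_lfunE A B u : (A - B) u = A u - B u.
Proof. by rewrite add_lfunE opp_lfunE. Qed.

Lemma comp_ketbra A a b : (A \o ketbra dot a b)%VF = ketbra dot (A a) b.
Proof. by apply/lfunP => u; rewrite comp_lfunE !ketbraE linearZ. Qed.

Lemma psdD A B : psd dot A -> psd dot B -> psd dot (A + B).
Proof. by move=> hA hB u; rewrite add_lfunE dotDl addr_ge0. Qed.

Lemma psdZ c A : 0 <= c -> psd dot A -> psd dot (c *: A).
Proof. by move=> hc hA u; rewrite scale_lfunE dotZl mulr_ge0. Qed.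

Lemma psd_ketbra a : psd dot (ketbra dot a a).
Proof. by move=> u; rewrite ketbraE dotZl [dot a u]dotC mul_conjC_ge0. Qed.

Lemma psdD_ker A B u : psd dot A -> psd dot B -> (A + B) u = 0 -> A u = 0 /\ B u = 0.
Proof.
move=> hA hB /(congr1 (dot^~ u)); rewrite /= add_lfunE dotDl dot0l => /eqP.
by rewrite paddr_eq0 // => /andP[/eqP Au /eqP Bu]; split; apply: (psd_eq0 (dot := dot)).
Qed.

(* By Cauchy-Schwarz for the form of [A], [|<A y, u>|^2 <= <A y, y> <A u, u>]. *)
Lemma psd_sub_ketbra A y : psd dot A -> A y != 0 ->
  0 < (dot (A y) y)^-1 /\
  psd dot (A - (dot (A y) y)^-1 *: ketbra dot (A y) (A y)).
Proof.
move=> hA Ay0; have Ayy : 0 < dot (A y) y.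
  by rewrite lt_def hA andbT; apply: contra_neq Ay0 => /(psd_eq0 hA).
split=> [|u]; first by rewrite invr_gt0.
rewrite sub_lfunE scale_lfunE ketbraE dotBl !dotZl subr_ge0 mulrC.
rewrite ler_pdivrMr // [dot u _]dotC [_^* * _]mulrC -normCK [leRHS]mulrC.
exact: psd_CauchySchwarz.
Qed.

(** Its second half turns the trace conditions on a measurement into operator identities. *)
Lemma lftrace_psd A B : psd dot A -> psd dot B ->
  0 <= lftrace (A \o B)%VF /\
  (lftrace (A \o B)%VF = 0 -> forall u, A (B u) = 0).
Proof.
(* Peel rank-one operators off [B] until it vanishes. *)
move=> hA; have [n] := ubnP (\dim {:H} - \dim (lker B)); elim: n B => // n IHn B Bn hB.
have [B0|] := eqVneq B 0.
  rewrite B0 comp_lfun0r; split=> [|_ u]; last by rewrite lfunE linear0.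
  by rewrite lftrace0.
case/lfunPn => y; rewrite lfunE /= => By0.
have [] := psd_sub_ketbra hB By0.
set c := _^-1; set a := B y; set B' := B - _ => cgt hB'.
have BE : B = B' + c *: ketbra dot a a by rewrite subrK.
have B'n : (\dim {:H} - \dim (lker B') < n)%N.
  have B'E u : B' u = B u - (c * dot u a) *: a.
    by rewrite sub_lfunE scale_lfunE ketbraE scalerA.
  suff lt : (\dim {:H} - \dim (lker B') < \dim {:H} - \dim (lker B))%N.
    exact: leq_trans lt Bn.
  (* [B'] keeps the kernel of [B] and also kills [y], since [c * dot y a = 1]; so the rank drops. *)
  apply: (ltn_codim_lker (v := y)) => // [u Bu|].
    have ua0 : dot u a = 0 by rewrite -[dot u a](psd_sym u y hB) Bu dot0l.
    by rewrite B'E Bu ua0 mulr0 scale0r subrr.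
  rewrite B'E; have -> : dot y a = dot a y by rewrite -[dot y a](psd_sym y y hB).
  by rewrite mulVf ?scale1r ?subrr // -invr_eq0; exact: lt0r_neq0.
have [tr0 ker0] := IHn B' B'n hB'.
have trE : lftrace (A \o B)%VF = lftrace (A \o B')%VF + c * dot (A a) a.
  by rewrite {1}BE comp_lfunDr lftraceD -comp_lfunZr lftraceZ comp_ketbra lftrace_ketbra.
have ca : 0 <= c * dot (A a) a by rewrite mulr_ge0 // ltW.
split=> [|/eqP]; first by rewrite trE addr_ge0.
rewrite trE paddr_eq0 // mulf_eq0 (gt_eqF cgt) => /andP[/eqP /ker0 AB' /eqP Aa] u.
rewrite BE add_lfunE linearD /= AB' add0r scale_lfunE ketbraE !linearZ /=.
by rewrite (psd_eq0 hA Aa) !scaler0.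
Qed.

End PositiveOperators.

(** * Range and kernel as complementary subspaces *)

Section RangeKernel.
Variables (K : fieldType) (V : vectType K) (A : 'End(V)).
Hypothesis A_core : forall u, A (A u) = 0 -> A u = 0.

Lemma capv_limg_lker : (limg A :&: lker A = 0)%VS.
Proof.
apply/eqP; rewrite -subv0; apply/subvP => u /memv_capP[/memv_imgP[v _ ->]].
by rewrite memv_ker memv0 => /eqP /A_core ->.
Qed.

Lemma addv_limg_lker : (limg A + lker A = fullv)%VS.
Proof.
apply/eqP; rewrite eqEdim subvf /= dimv_disjoint_sum; last exact: capv_limg_lker.
by rewrite -(limg_ker_dim A fullv) capfv addnC.
Qed.

Lemma range_kernel_split u : exists y k, A k = 0 /\ u = A y + k.
Proof.
have : u \in (limg A + lker A)%VS by rewrite addv_limg_lker memvf.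
case/memv_addP => _ /memv_imgP[y _ ->] [k]; rewrite memv_ker => /eqP Ak ->.
by exists y, k.
Qed.

End RangeKernel.

(** * Ranges, supports and orthogonal projections of positive operators *)

Section Supports.
Variables (R : realType) (H : vectType R[i]) (dot : {dot H for Num.conj}).
Implicit Types (a b u v w : H) (A B : 'End(H)) (c : R[i]).

Lemma psd_core A u : psd dot A -> A (A u) = 0 -> A u = 0.
Proof.
move=> hA AAu; apply/eqP; rewrite -(dnorm_eq0 dot).
by rewrite [dot _ _](psd_sym u (A u) hA) AAu dot0r.
Qed.

(** The range is the orthogonal complement of the kernel: pairing [a = A y + k] with its kernel part
    [k] leaves only [dot k k]. *)
Lemma psd_range A a : psd dot A -> (forall u, A u = 0 -> dot a u = 0) ->
  exists y, a = A y.
Proof.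
move=> hA ha; have [y [k [Ak aE]]] := range_kernel_split (fun u => @psd_core A u hA) a.
exists y; suff k0 : k = 0 by rewrite aE k0 addr0.
apply/eqP; rewrite -(dnorm_eq0 dot).
by have := ha k Ak; rewrite aE dotDl [dot (A y) k](psd_sym y k hA) Ak dot0r add0r => ->.
Qed.

(** Orthogonal complements reverse inclusions. For the forward direction, symmetry puts the range of
    [A] inside its support. *)
Lemma supp_subP A B : psd dot A -> psd dot B ->
  (supp dot A <= supp dot B)%VS <-> (forall u, B u = 0 -> A u = 0).
Proof.
move=> hA hB; split=> [/subvP sub u Bu|sub].
  apply: (dot_nondeg (dot := dot)) => v; rewrite [LHS](psd_sym u v hA) [LHS]dotC.
  suff /sub /mem_orthovP -> : A v \in supp dot A by rewrite ?conjC0 // memv_ker Bu.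
  apply/mem_orthovP => w; rewrite memv_ker => /eqP Aw.
  by rewrite [LHS](psd_sym v w hA) Aw dot0r.
apply/subvP => v /mem_orthovP hv; apply/mem_orthovP => w; rewrite memv_ker.
by move=> /eqP /sub Aw; apply: hv; rewrite memv_ker Aw.
Qed.

(** The projection onto the range along the kernel is orthogonal, because the range and the kernel
    of a symmetric operator are. *)
Lemma range_projection A : psd dot A -> exists P : 'End(H),
  [/\ forall u, exists y, P u = A y, forall u, P (P u) = P u,
    forall u, A (P u) = A u & forall u v, dot (P u) v = dot u (P v)].
Proof.
move=> hA; have core u : A (A u) = 0 -> A u = 0 by exact: psd_core.
pose P := daddv_pi (limg A) (lker A).
have PA u : exists y, P u = A y.
  by have /memv_imgP[y _ ->] : P u \in limg A by [exact: memv_pi]; exists y.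
have PE u : u = P u + daddv_pi (lker A) (limg A) u.
  rewrite daddv_pi_add //; first exact: capv_limg_lker.
  by rewrite addv_limg_lker // memvf.
have AP0 u : A (u - P u) = 0.
  by rewrite [X in X - _]PE addrAC subrr add0r; apply/eqP; rewrite -memv_ker memv_pi.
have orth u v : dot (P u) v = dot (P u) (P v).
  apply/eqP; rewrite -subr_eq0 -dotBr; have [y ->] := PA u.
  by rewrite [dot _ _](psd_sym y (v - P v) hA) AP0 dot0r.
exists P; split=> // [u|u|u v].
  by rewrite daddv_pi_proj // capv_limg_lker.
  by apply/eqP; rewrite eq_sym -subr_eq0 -linearB /= AP0.
by rewrite orth [RHS]dotC [dot (P v) u]orth -dotC.
Qed.

End Supports.

(** * Uniqueness of the optimal proper measurement, and compression to the support *)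

Section Uniqueness.
Variables (R : realType) (H : vectType R[i]) (dot : {dot H for Num.conj}).
Implicit Types (a u v : H) (gamma : 'End(H)) (E F : measurement H).

(** Exchanging the two states carries the uniqueness of the first operator over to the second. *)
Definition swap_outcomes E := Measurement (E_2 E) (E_1 E) (E_inconclusive E).

Lemma is_usd_swap gamma1 gamma2 E :
  is_usd dot gamma1 gamma2 E -> is_usd dot gamma2 gamma1 (swap_outcomes E).
Proof.
case: E => E1 E2 E0 [[h1 h2 h0] s t2 t1]; split; [by split| |exact: t1|exact: t2].
by rewrite /= (addrC E2).
Qed.

Lemma success_prob_swap gamma1 gamma2 E :
  success_prob gamma2 gamma1 (swap_outcomes E) = success_prob gamma1 gamma2 E.
Proof. exact: addrC. Qed.

Lemma optimal_usd_swap gamma1 gamma2 E :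
  optimal_usd dot gamma1 gamma2 E -> optimal_usd dot gamma2 gamma1 (swap_outcomes E).
Proof.
move=> opt F /is_usd_swap /opt.
by rewrite (success_prob_swap gamma2 gamma1) (success_prob_swap gamma1 gamma2).
Qed.

Lemma proper_usd_swap gamma1 gamma2 E :
  proper_usd dot gamma1 gamma2 E -> proper_usd dot gamma2 gamma1 (swap_outcomes E).
Proof.
by rewrite /proper_usd /supp_pair /= (addrC (E_1 E)) (addrC gamma1).
Qed.

Section Fixed.
Variables gamma1 gamma2 : 'End(H).
Hypotheses (gamma1_psd : psd dot gamma1) (gamma2_psd : psd dot gamma2).

(** For positive operators, a vanishing trace of the product forces [A B = 0]; taking adjoints gives
    [B A = 0]. *)
Lemma usd_annihilates E u :
  is_usd dot gamma1 gamma2 E -> gamma1 (E_2 E u) = 0 /\ gamma2 (E_1 E u) = 0.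
Proof.
case=> -[h1 h2 h0] _ tr2 tr1.
have adj A B : psd dot A -> psd dot B -> lftrace (A \o B)%VF = 0 -> B (A u) = 0.
  move=> hA hB tr; have [_ /(_ tr) AB0] := lftrace_psd hA hB.
  apply: (dot_nondeg (dot := dot)) => v.
  by rewrite [LHS](psd_sym _ _ hB) [LHS](psd_sym _ _ hA) AB0 dot0r.
by split; apply: adj.
Qed.

(** The kernel of a sum of positive operators is the intersection of their kernels. *)
Lemma proper_usdP E : is_usd dot gamma1 gamma2 E ->
  proper_usd dot gamma1 gamma2 E <->
  (forall u, gamma1 u = 0 -> gamma2 u = 0 -> E_1 E u = 0 /\ E_2 E u = 0).
Proof.
case=> -[h1 h2 h0] _ _ _.
rewrite /proper_usd /supp_pair (supp_subP (psdD h1 h2) (psdD gamma1_psd gamma2_psd)).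
split=> [sub u u1 u2|sub u /(psdD_ker gamma1_psd gamma2_psd)[u1 u2]].
  by apply: (psdD_ker h1 h2); apply: sub; rewrite add_lfunE u1 u2 addr0.
by have [e1 e2] := sub u u1 u2; rewrite add_lfunE e1 e2 addr0.
Qed.

Definition midpoint E F := Measurement (2^-1 *: (E_1 E + E_1 F))
  (2^-1 *: (E_2 E + E_2 F)) (2^-1 *: (E_inconclusive E + E_inconclusive F)).

Lemma is_usd_midpoint E F : is_usd dot gamma1 gamma2 E ->
  is_usd dot gamma1 gamma2 F -> is_usd dot gamma1 gamma2 (midpoint E F).
Proof.
case=> -[h1 h2 h0] s t2 t1 [[k1 k2 k0]] s' t2' t1'.
have half : 0 <= 2^-1 :> R[i] by rewrite invr_ge0 ler0n.
split.
- by split; apply: psdZ => //; apply: psdD.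
- have half2 : 2^-1 + 2^-1 = 1 :> R[i] by field.
  rewrite /= -!scalerDr (addrACA (E_1 E)) (addrACA (E_1 E + E_2 E)) s s'.
  by rewrite scalerDr -scalerDl half2 scale1r.
- by rewrite /= -comp_lfunZl comp_lfunDl lftraceZ lftraceD t2 t2' addr0 mulr0.
- by rewrite /= -comp_lfunZl comp_lfunDl lftraceZ lftraceD t1 t1' addr0 mulr0.
Qed.

Lemma success_prob_midpoint E F : success_prob gamma1 gamma2 (midpoint E F) =
  2^-1 * (success_prob gamma1 gamma2 E + success_prob gamma1 gamma2 F).
Proof.
rewrite /success_prob /= -!comp_lfunZl !comp_lfunDl !lftraceZ !lftraceD.
by rewrite -mulrDr addrACA.
Qed.

(** With [a = E_inconclusive E y], the operator [c |a><a|] is moved from the inconclusive operator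
    to the first one. What remains is positive for [c = (dot a y)^-1], and [gamma2 a = 0] keeps the
    measurement unambiguous. *)
Lemma usd_improve E y : is_usd dot gamma1 gamma2 E ->
  E_inconclusive E y != 0 -> gamma2 (E_inconclusive E y) = 0 ->
  exists c F, [/\ 0 < c, is_usd dot gamma1 gamma2 F &
    success_prob gamma1 gamma2 F = success_prob gamma1 gamma2 E +
      c * dot (gamma1 (E_inconclusive E y)) (E_inconclusive E y)].
Proof.
case=> -[h1 h2 h0] s t2 t1 ay ga; set a := E_inconclusive E y in ay ga *.
have [cgt h0'] := psd_sub_ketbra h0 ay; move: cgt h0'; rewrite -/a.
set c := _^-1 => cgt h0'.
have trk gamma : lftrace ((E_1 E + c *: ketbra dot a a) \o gamma)%VF =
    lftrace (E_1 E \o gamma)%VF + c * dot (gamma a) a.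
  rewrite comp_lfunDl lftraceD -comp_lfunZl lftraceZ (lftraceC (ketbra dot a a)).
  by rewrite comp_ketbra lftrace_ketbra.
exists c, (Measurement (E_1 E + c *: ketbra dot a a) (E_2 E)
             (E_inconclusive E - c *: ketbra dot a a)); split=> //; last first.
  by rewrite /success_prob /= trk addrAC.
split=> //=.
- by split=> //; apply: psdD => //; apply: psdZ; [exact: ltW|exact: psd_ketbra].
- by rewrite (addrAC (E_1 E)) (addrC (E_inconclusive E)) addrA addrK.
- by rewrite trk t1 ga dot0l mulr0 addr0.
Qed.

Lemma usd_E1_unique E F :
  is_usd dot gamma1 gamma2 E -> optimal_usd dot gamma1 gamma2 E ->
  proper_usd dot gamma1 gamma2 E ->
  is_usd dot gamma1 gamma2 F -> optimal_usd dot gamma1 gamma2 F ->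
  proper_usd dot gamma1 gamma2 F -> E_1 E = E_1 F.
Proof.
move=> usdE optE /(proper_usdP usdE) propE usdF optF /(proper_usdP usdF) propF.
pose D1 := E_1 E - E_1 F; pose D2 := E_2 E - E_2 F.
have [[e1 e2 e0] sE _ _] := usdE; have [[f1 f2 f0] sF _ _] := usdF.
have D1_sym u v : dot (D1 u) v = dot u (D1 v).
  by rewrite !sub_lfunE dotBl dotBr (psd_sym _ _ e1) (psd_sym _ _ f1).
have D1_core u : D1 (D1 u) = 0 -> D1 u = 0.
  move=> DDu; apply/eqP; rewrite -(dnorm_eq0 dot).
  by rewrite [dot _ _](D1_sym u (D1 u)) DDu dot0r.
have gD1 u : gamma2 (D1 u) = 0.
  have [_ gE] := usd_annihilates u usdE; have [_ gF] := usd_annihilates u usdF.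
  by rewrite sub_lfunE linearB /= gE gF subrr.
have gD2 u : gamma1 (D2 u) = 0.
  have [gE _] := usd_annihilates u usdE; have [gF _] := usd_annihilates u usdF.
  by rewrite sub_lfunE linearB /= gE gF subrr.
(* [D1 u] then lies in both kernels, so properness makes [E_1 E] and [E_1 F], hence [D1], vanish on
   it. *)
have ker_D1 u : gamma1 (D1 u) = 0 -> D1 u = 0.
  move=> g1; apply: D1_core; rewrite sub_lfunE.
  by have [-> _] := propE _ g1 (gD1 u); have [-> _] := propF _ g1 (gD1 u); rewrite subrr.
apply/eqP; rewrite -subr_eq0; apply: contraT => /lfunPn[x].
rewrite -/D1 zero_lfunE => D1x.
pose M := midpoint E F; have usdM : is_usd dot gamma1 gamma2 M by exact: is_usd_midpoint.
have [[_ _ m0] _ _ _] := usdM.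
have kerM u : E_inconclusive M u = 0 -> D1 u = 0.
  rewrite /= scale_lfunE => /eqP; rewrite scaler_eq0 invr_eq0 pnatr_eq0 /= => /eqP.
  move=> /(psdD_ker e0 f0)[E0 F0]; apply: ker_D1.
  (* Where both inconclusive operators vanish, [E_1 + E_2] is the identity for [E] and for [F]. *)
  have -> : D1 u = - D2 u; last by rewrite linearN /= gD2 oppr0.
  have sEu : E_1 E u + E_2 E u = u.
    by rewrite -[RHS](id_lfunE u) -sE !add_lfunE E0 addr0.
  have sFu : E_1 F u + E_2 F u = u.
    by rewrite -[RHS](id_lfunE u) -sF !add_lfunE F0 addr0.
  rewrite /D1 /D2 !sub_lfunE opprB; apply/eqP; rewrite subr_eq addrAC eq_sym subr_eq.
  by rewrite sEu addrC sFu.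
have [y aE] : exists y, D1 x = E_inconclusive M y.
  by apply: (psd_range m0) => u /kerM D1u; rewrite D1_sym D1u dot0r.
have [||c [N [cgt usdN succN]]] := usd_improve (y := y) usdM; rewrite -?aE //.
have EF : success_prob gamma1 gamma2 E = success_prob gamma1 gamma2 F.
  by apply/eqP; rewrite eq_le optF // optE.
have halfK (z : R[i]) : 2^-1 * (z + z) = z by field.
(* The midpoint has the optimal value too, so the gain [c * dot (gamma1 a) a] with [a = D1 x] cannot
   be positive. *)
have := optE _ usdN; rewrite succN success_prob_midpoint -EF halfK.
rewrite gerDl pmulr_rle0 // -aE => le0.
case/eqP: D1x; apply: ker_D1; apply: (psd_eq0 gamma1_psd).
by apply/eqP; rewrite eq_le le0 gamma1_psd.
Qed.

(** Each conclusive operator [A] becomes [P A P], with [P] the projection onto the range of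
    [gamma1 + gamma2]. The traces survive because [P] fixes [gamma1] and [gamma2] on both sides. *)
Lemma usd_compress F : is_usd dot gamma1 gamma2 F ->
  exists E, [/\ is_usd dot gamma1 gamma2 E, proper_usd dot gamma1 gamma2 E
    & success_prob gamma1 gamma2 E = success_prob gamma1 gamma2 F].
Proof.
case=> -[h1 h2 h0] s t2 t1.
have hG := psdD gamma1_psd gamma2_psd.
have [P [PG PP GP P_sym]] := range_projection hG.
(* [P u - u] is in the kernel of the sum, hence in both kernels. *)
have gP u : gamma1 (P u) = gamma1 u /\ gamma2 (P u) = gamma2 u.
  have /(psdD_ker gamma1_psd gamma2_psd) : (gamma1 + gamma2) (P u - u) = 0.
    by rewrite linearB /= GP subrr.
  by rewrite !linearB /= => -[/eqP + /eqP]; rewrite !subr_eq0 => /eqP -> /eqP ->.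
have Pg A : psd dot A -> (forall u, A (P u) = A u) -> (P \o A)%VF = A.
  move=> hA AP; apply/lfunP => u; rewrite comp_lfunE; apply/eqP; rewrite -subr_eq0.
  apply/eqP; apply: (dot_nondeg (dot := dot)) => v; rewrite dotBl P_sym.
  by rewrite !(psd_sym _ _ hA) AP subrr.
have trP A B : psd dot A -> (forall u, A (P u) = A u) ->
    lftrace ((P \o (B \o P)) \o A)%VF = lftrace (B \o A)%VF.
  move=> hA AP; rewrite -!comp_lfunA (Pg _ hA AP) lftraceC -comp_lfunA.
  by congr (lftrace (_ \o _)%VF); apply/lfunP => u; rewrite comp_lfunE AP.
have psdP A : psd dot A -> psd dot (P \o (A \o P))%VF.
  by move=> hA u; rewrite !comp_lfunE P_sym.
pose E1 := (P \o (E_1 F \o P))%VF; pose E2 := (P \o (E_2 F \o P))%VF.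
have g1P u : gamma1 (P u) = gamma1 u by have [] := gP u.
have g2P u : gamma2 (P u) = gamma2 u by have [] := gP u.
pose E := Measurement E1 E2 (\1 - (E1 + E2))%VF.
have usdE : is_usd dot gamma1 gamma2 E.
  split; rewrite /= ?trP //; last by rewrite addrC subrK.
  split; [exact: psdP|exact: psdP|move=> u].
  (* The new inconclusive operator is [(1 - P) + P E_? P], a sum of positive operators. *)
  have -> : (\1 - (E1 + E2))%VF u = (u - P u) + P (E_inconclusive F (P u)).
    have -> : E_inconclusive F (P u) = P u - (E_1 F (P u) + E_2 F (P u)).
      by rewrite -[X in _ = X - _](id_lfunE (P u)) -s !add_lfunE addrC addrA addNr add0r.
    rewrite sub_lfunE id_lfunE add_lfunE !comp_lfunE !linearB !linearD /= PP.
    by rewrite [RHS]addrA subrK.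
  have Pu_orth : dot (u - P u) (P u) = 0.
    by rewrite -P_sym linearB /= PP subrr dot0l.
  rewrite dotDl P_sym addr_ge0 //.
  have -> : dot (u - P u) u = dot (u - P u) (u - P u).
    by rewrite [RHS]dotBr Pu_orth subr0.
  exact: dnorm_ge0.
exists E; split=> //; last by rewrite /success_prob !trP.
apply/(proper_usdP usdE) => u g1u g2u.
have Pu0 : P u = 0.
  have [y Py] := PG u; rewrite Py; apply: (psd_core hG); rewrite -Py GP.
  by rewrite add_lfunE g1u g2u addr0.
by rewrite !comp_lfunE Pu0 !linear0.
Qed.

End Fixed.
End Uniqueness.

(** * Attainment of linear maxima under affine constraints *)

Lemma continuous_lincomb (R : realType) (T : topologicalType) (a b : T -> R)
    (x y : R) :
  continuous a -> continuous b -> continuous (fun z => a z * x + b z * y).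
Proof.
move=> ca cb z; apply: cvgD; apply: cvgMr_tmp; [exact: ca|exact: cb].
Qed.

(** Separates nonnegativity in [R[i]] into a real inequality and a real equation, both closed
    conditions. *)
Lemma addc_ge0 (R : rcfType) (p q : R[i]) : 0 <= p + q <->
  - complex.Re p <= complex.Re q /\ complex.Im q = - complex.Im p.
Proof.
case: p q => a b [x y]; rewrite lecE /= addr_eq0 -[a]opprK addrC subr_ge0 opprK.
by split=> [/andP[/eqP -> ->]|[-> ->]]; rewrite ?opprK ?eqxx.
Qed.

Section Attainment.
Variables (R : realType) (I : finType) (W : lmodType R[i]).
Variables (B : I -> W) (e : I -> W -> R[i]) (M : I -> R).
Hypothesis coordE : forall w, w = \sum_i e i w *: B i.

(** [W] carries no topology, so compactness is argued on real coordinates: [true] indexes real parts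
    and [false] imaginary parts. *)
Let J : eqType := (I * bool)%type.
Let Z : topologicalType := prod_topology (fun _ : J => R : topologicalType).

Let pt (z : Z) : W := \sum_i (z (i, true) +i* z (i, false))%C *: B i.

Let continuous_functional (phi : W -> R[i]) : scalar phi ->
  continuous (fun z : Z => complex.Re (phi (pt z)) : R) /\
  continuous (fun z : Z => complex.Im (phi (pt z)) : R).
Proof.
move=> phi_lin.
have phi0 : phi 0 = 0.
  have := phi_lin 1 0 0; rewrite scale1r addr0 mul1r => /eqP.
  by rewrite -subr_eq0 opprD addrA subrr add0r oppr_eq0 => /eqP.
have phiE z : phi (pt z) = \sum_i (z (i, true) +i* z (i, false))%C * phi (B i).
  rewrite (big_morph phi (id1 := 0) (op1 := +%R)) // => [|u v].
    by apply: eq_bigr => i _; rewrite -[X in phi X]addr0 phi_lin phi0 addr0.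
  by rewrite -[u]scale1r phi_lin mul1r scale1r.
have proj_cont j : continuous (fun z : Z => z j : R).
  exact: (@proj_continuous J (fun _ => R : topologicalType) j).
have sum_cont (F : I -> Z -> R) : (forall i, continuous (F i)) ->
    continuous (fun z => \sum_i F i z).
  move=> F_cont; apply: continuous_big => // -[x y]; exact: add_continuous.
have lin_cont j k (x y : R) : continuous (fun z : Z => z j * x + z k * y : R).
  exact: continuous_lincomb.
have ReE z : complex.Re (phi (pt z)) = \sum_i
    (z (i, true) * complex.Re (phi (B i)) + z (i, false) * - complex.Im (phi (B i))).
  rewrite phiE (big_morph (@complex.Re R) (id1 := 0) (op1 := +%R)) //;
    last by case=> ? ? [].
  by apply: eq_bigr => i _; case: (phi (B i)) => x y /=; rewrite mulrN.
have ImE z : complex.Im (phi (pt z)) = \sum_i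
    (z (i, true) * complex.Im (phi (B i)) + z (i, false) * complex.Re (phi (B i))).
  rewrite phiE (big_morph (@complex.Im R) (id1 := 0) (op1 := +%R)) //;
    last by case=> ? ? [].
  by apply: eq_bigr => i _; case: (phi (B i)).
by split; [rewrite (funext ReE)|rewrite (funext ImE)]; apply: sum_cont => i;
  apply: lin_cont.
Qed.

(** Pulled back along [pt], the set [K] is closed. Its part in a compact box already reaches every
    point of [K], so the extreme value theorem applies there. *)
Lemma linear_attains_max (T : Type) (k : T -> R[i]) (f : T -> W -> R[i])
    (g : W -> R[i]) (K := fun w => forall t, 0 <= k t + f t w) :
  (forall t, scalar (f t)) -> scalar g ->
  (forall w, K w -> forall i, `|e i w| <= (M i)%:C%C) ->
  (exists w, K w) ->
  exists2 w, K w & forall w', K w' -> complex.Re (g w') <= complex.Re (g w).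
Proof.
move=> f_lin g_lin K_bounded [w0 Kw0].
pose box := [set z : Z | forall j : J, `[- M j.1, M j.1]%classic (z j)]%classic.
have box_compact : compact box.
  exact: (@tychonoff J (fun _ => R : topologicalType)
    (fun j => `[- M j.1, M j.1]%classic) (fun j => @segment_compact _ _ _)).
have K_closed : closed [set z : Z | K (pt z)]%classic.
  have -> : [set z : Z | K (pt z)]%classic = (\bigcap_(t in [set: T])
     ([set z | (- complex.Re (k t) <= complex.Re (f t (pt z)))%R] `&`
      [set z | (complex.Im (f t (pt z)) = - complex.Im (k t))%R]))%classic.
    apply/seteqP; split=> z /= Kz t; first by move=> _; apply/addc_ge0/Kz.
    exact/addc_ge0/Kz.
  apply: closed_bigI => t _; have [re im] := continuous_functional (f_lin t).
  apply: closedI.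
    apply: (@preimage_closed _ _ (fun z : Z => complex.Re (f t (pt z)) : R)
      [set x : R | (- complex.Re (k t) <= x)%R]%classic); last exact: closed_ge.
    by move=> z _; exact: re.
  apply: (@preimage_closed _ _ (fun z : Z => complex.Im (f t (pt z)) : R)
    [set x : R | (x = - complex.Im (k t))%R]%classic); last exact: closed_eq.
  by move=> z _; exact: im.
(* The real and imaginary parts of [e i w] are bounded by its modulus, hence by [M i]. *)
have coords w : K w -> exists2 z, box z & pt z = w.
  move=> Kw.
  exists (fun j : J => if j.2 then complex.Re (e j.1 w) else complex.Im (e j.1 w)).
    move=> [i b] /=; have := K_bounded w Kw i.
    rewrite normc_def lecR in_itv /= -ler_norml; apply: le_trans.
    by case: b; rewrite -sqrtr_sqr ler_wsqrtr ?lerDl ?lerDr ?sqr_ge0.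
  rewrite [RHS]coordE; apply: eq_bigr => i _ /=; by case: (e i w).
have [z0 box0 z0E] := coords w0 Kw0.
have ne : (box `&` [set z : Z | K (pt z)] !=set0)%classic.
  by exists z0; split=> //=; rewrite z0E.
have [z zA zmax] := compact_EVT_max ne (compact_closedI box_compact K_closed)
  (continuous_subspaceT (continuous_functional g_lin).1).
move: zA; rewrite inE => -[_ Kz]; exists (pt z) => // w Kw.
have [z' box' z'E] := coords w Kw; rewrite -z'E.
by apply: zmax; rewrite inE; split=> //=; rewrite z'E.
Qed.

End Attainment.

(** * Existence of an optimal measurement *)

Section Existence.
Variables (R : realType) (H : vectType R[i]) (dot : {dot H for Num.conj}).

Let n := \dim {:H}.
Let b (i : 'I_n) : H := (vbasis {:H})`_i.

(** The matrix of the form [dot (A u) v]. Cauchy-Schwarz bounds its entries directly, although the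
    basis need not be orthonormal. *)
Definition gram (A : 'End(H)) : 'M[R[i]]_n := \matrix_(i, j) dot (A (b i)) (b j).

Fact gram_linear : linear gram.
Proof.
move=> c A B; apply/matrixP => i j.
by rewrite !mxE add_lfunE scale_lfunE dotDl dotZl.
Qed.

HB.instance Definition _ := GRing.isLinear.Build _ _ _ _ gram gram_linear.

Lemma lker_gram : lker (linfun gram) == 0%VS.
Proof.
rewrite -subv0; apply/subvP => A; rewrite memv_ker lfunE memv0 => /eqP A0.
have bA0 i j : dot (A (b i)) (b j) = 0 by have /matrixP/(_ i j) := A0; rewrite !mxE.
have span_b (v : H) : exists c : 'I_n -> R[i], v = \sum_i c i *: b i.
  by exists (fun i => coord (vbasis {:H}) i v); exact: coord_vbasis (memvf v).
have Ab0 i : A (b i) = 0.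
  apply: (dot_nondeg (dot := dot)) => v; have [c ->] := span_b v.
  rewrite [LHS]dotC dot_suml big1 ?conjC0 // => j _.
  by rewrite dotZl [dot _ _]dotC bA0 conjC0 mulr0.
apply/eqP/lfunP => u; have [c ->] := span_b u.
by rewrite zero_lfunE linear_sum big1 // => i _; rewrite linearZ /= Ab0 scaler0.
Qed.

(** [gram] is injective; [B] consists of the images of the elementary matrices under a left
    inverse. *)
Lemma gram_coord : exists B : 'I_n * 'I_n -> 'End(H),
  forall A : 'End(H), A = \sum_p dot (A (b p.1)) (b p.2) *: B p.
Proof.
exists (fun p => (linfun gram)^-1%VF (delta_mx p.1 p.2)) => A.
rewrite -[LHS](lker0_lfunK lker_gram) lfunE /=.
rewrite [gram A]matrix_sum_delta pair_bigA /= linear_sum.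
by apply: eq_bigr => -[i j] _; rewrite linearZ mxE.
Qed.

(** The bound [x <= 1 + x ^+ 2] for real [x >= 0] avoids square roots; Cauchy-Schwarz then applies
    to the square. *)
Lemma psd_le1_entry A u v : psd dot A -> (forall w, dot (A w) w <= dot w w) ->
  `|dot (A u) v| <= 1 + dot u u * dot v v.
Proof.
move=> hA A1; apply: (@le_trans _ _ (1 + `|dot (A u) v| ^+ 2)).
  set x := `|_|; have x0 : 0 <= x by exact: normr_ge0.
  have [x1|x1] := real_leP (ger0_real x0) (real1 _).
    by rewrite (le_trans x1) // lerDl exprn_ge0.
  by rewrite expr2 ler_wpDl ?ler_peMl // ltW.
rewrite lerD2l (le_trans (psd_CauchySchwarz u v hA)) // ler_pM ?hA //.
Qed.

Variables gamma1 gamma2 : 'End(H).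
Hypotheses (gamma1_psd : psd dot gamma1) (gamma2_psd : psd dot gamma2).

(* Positivity of the operators makes the traces nonnegative, so bounding them by
   [0] is enough to make them vanish. *)
Inductive usd_constraint :=
  | E1_ge0 of H | E2_ge0 of H | Einc_ge0 of H | tr21_le0 | tr12_le0.

(** Only positivity of [1 - (E_1 + E_2)] is inhomogeneous; its constant term is [dot u u]. *)
Let constraint_cst (t : usd_constraint) : R[i] :=
  if t is Einc_ge0 u then dot u u else 0.

Let constraint (t : usd_constraint) (w : 'End(H) * 'End(H)) : R[i] :=
  match t with
  | E1_ge0 u => dot (w.1 u) u
  | E2_ge0 u => dot (w.2 u) u
  | Einc_ge0 u => - dot ((w.1 + w.2) u) u
  | tr21_le0 => - lftrace (w.2 \o gamma1)%VF
  | tr12_le0 => - lftrace (w.1 \o gamma2)%VF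
  end.

Let success (w : 'End(H) * 'End(H)) : R[i] :=
  lftrace (w.1 \o gamma1)%VF + lftrace (w.2 \o gamma2)%VF.

Let usd_of (w : 'End(H) * 'End(H)) := Measurement w.1 w.2 (\1%VF - (w.1 + w.2)).

Let usd_constraintP (w : 'End(H) * 'End(H)) :
  is_usd dot gamma1 gamma2 (usd_of w) <->
  forall t, 0 <= constraint_cst t + constraint t w.
Proof.
split=> [[[h1 h2 h0] _ t2 t1] [u|u|u||] /=|h].
- by rewrite add0r.
- by rewrite add0r.
- by have := h0 u; rewrite /= sub_lfunE id_lfunE dotBl.
- by rewrite [lftrace _]t2 oppr0 addr0.
- by rewrite [lftrace _]t1 oppr0 addr0.
have h1 : psd dot w.1 by move=> u; have := h (E1_ge0 u); rewrite /= add0r.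
have h2 : psd dot w.2 by move=> u; have := h (E2_ge0 u); rewrite /= add0r.
have tr0 A B : psd dot A -> psd dot B ->
    0 <= 0 - lftrace (A \o B)%VF -> lftrace (A \o B)%VF = 0.
  move=> hA hB; rewrite add0r oppr_ge0 => le0.
  by apply/eqP; rewrite eq_le le0 (lftrace_psd hA hB).1.
split=> /=; [split=> // u| |exact: (tr0 _ _ h2 _ (h tr21_le0))
  |exact: (tr0 _ _ h1 _ (h tr12_le0))].
  by rewrite sub_lfunE id_lfunE dotBl; exact: (h (Einc_ge0 u)).
by rewrite addrC subrK.
Qed.

Let constraint_linear t : scalar (constraint t).
Proof.
move=> c w w'; case: t => [u|u|u||] /=.
- by rewrite add_lfunE scale_lfunE dotDl dotZl.
- by rewrite add_lfunE scale_lfunE dotDl dotZl.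
- by rewrite !(add_lfunE, scale_lfunE, dotDl, dotZl); ring.
- by rewrite comp_lfunDl lftraceD -comp_lfunZl lftraceZ opprD mulrN.
- by rewrite comp_lfunDl lftraceD -comp_lfunZl lftraceZ opprD mulrN.
Qed.

Let success_linear : scalar success.
Proof.
move=> c w w'; rewrite /success /= !comp_lfunDl !lftraceD -!comp_lfunZl !lftraceZ.
by rewrite mulrDr addrACA.
Qed.

Lemma success_prob_ge0 E : is_usd dot gamma1 gamma2 E ->
  0 <= success_prob gamma1 gamma2 E.
Proof.
case=> -[h1 h2 _] _ _ _; rewrite addr_ge0 //.
  by have [] := lftrace_psd h1 gamma1_psd.
by have [] := lftrace_psd h2 gamma2_psd.
Qed.

Lemma usd_eta E : is_usd dot gamma1 gamma2 E -> E = usd_of (E_1 E, E_2 E).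
Proof.
by case: E => E1 E2 E0 [_ /= s _ _]; rewrite /usd_of /= -s (addrC _ E0) addrK.
Qed.

(** The maximization runs over pairs [(E_1, E_2)], as completeness determines the inconclusive
    operator. The coordinates are the Gram entries of both components. *)
Lemma optimal_usd_exists :
  exists E, is_usd dot gamma1 gamma2 E /\ optimal_usd dot gamma1 gamma2 E.
Proof.
have [B BE] := gram_coord.
pose I := ('I_n * 'I_n + 'I_n * 'I_n)%type.
pose B' (p : I) : 'End(H) * 'End(H) :=
  match p with inl p => (B p, 0) | inr p => (0, B p) end.
pose e (p : I) (w : 'End(H) * 'End(H)) := match p with
  | inl p => dot (w.1 (b p.1)) (b p.2) | inr p => dot (w.2 (b p.1)) (b p.2) end.
pose bound (p : 'I_n * 'I_n) := 1 + dot (b p.1) (b p.1) * dot (b p.2) (b p.2).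
pose M (p : I) := complex.Re (bound (match p with inl p => p | inr p => p end)).
have boundE p : (complex.Re (bound p))%:C%C = bound p.
  by apply: RRe_real; rewrite ger0_real // addr_ge0 // mulr_ge0 // dnorm_ge0.
have coordE w : w = \sum_p e p w *: B' p.
  rewrite big_sumType /=.
  have fst_sum : \sum_p dot (w.1 (b p.1)) (b p.2) *: B' (inl p) = (w.1, 0).
    rewrite [in RHS](BE w.1); apply: (big_ind2 (fun x y => x = (y, 0))) => //.
      by move=> ? ? ? ? -> ->; congr (_, _); rewrite addr0.
    by move=> p _; congr (_, _); rewrite scaler0.
  have snd_sum : \sum_p dot (w.2 (b p.1)) (b p.2) *: B' (inr p) = (0, w.2).
    rewrite [in RHS](BE w.2); apply: (big_ind2 (fun x y => x = (0, y))) => //.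
      by move=> ? ? ? ? -> ->; congr (_, _); rewrite addr0.
    by move=> p _; congr (_, _); rewrite scaler0.
  rewrite fst_sum snd_sum; case: w {fst_sum snd_sum} => A1 A2.
  by congr (_, _); rewrite ?addr0 ?add0r.
have [||w Kw wmax] := linear_attains_max (k := constraint_cst) (M := M) coordE
   constraint_linear success_linear.
- move=> w /usd_constraintP[[h1 h2 h0] _ _ _] p.
  (* Positivity of the inconclusive operator bounds each of the other two by the identity. *)
  have le1 A u : A = w.1 \/ A = w.2 -> dot (A u) u <= dot u u.
    have := h0 u; rewrite /= sub_lfunE id_lfunE add_lfunE dotBl dotDl subr_ge0.
    by move=> le [] ->; apply: le_trans le; rewrite ?lerDl ?lerDr ?h1 ?h2.
  by case: p => p; rewrite /M boundE; apply: psd_le1_entry => // u; apply: le1;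
    [left|right].
(* The always inconclusive measurement is feasible. *)
- exists (0, 0); apply/usd_constraintP; split=> /=.
  + by split=> u; rewrite ?addr0 ?subr0 ?zero_lfunE ?id_lfunE ?dot0l ?dnorm_ge0.
  + by rewrite addrC subrK.
  + by rewrite comp_lfun0l lftrace0.
  + by rewrite comp_lfun0l lftrace0.
have usdE : is_usd dot gamma1 gamma2 (usd_of w) by exact/usd_constraintP.
(* Both success probabilities are real, so comparing real parts decides the order in [R[i]]. *)
exists (usd_of w); split=> // F usdF; rewrite lecE.
rewrite (ger0_Im (success_prob_ge0 usdF)) (ger0_Im (success_prob_ge0 usdE)) eqxx /=.
by apply: (wmax (E_1 F, E_2 F)); apply/usd_constraintP; rewrite -usd_eta.
Qed.

End Existence.

Theorem proposition11 (R : realType) (H : vectType R[i])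
    (dot : {dot H for Num.conj}) (gamma1 gamma2 : 'End(H))
    (gamma1_psd : psd dot gamma1) (gamma2_psd : psd dot gamma2) :
  exists! E : measurement H,
    [/\ is_usd dot gamma1 gamma2 E,
        optimal_usd dot gamma1 gamma2 E
      & proper_usd dot gamma1 gamma2 E].
Proof.
have [E0 [usdE0 optE0]] := optimal_usd_exists gamma1_psd gamma2_psd.
have [E [usdE propE succE]] := usd_compress gamma1_psd gamma2_psd usdE0.
have optE : optimal_usd dot gamma1 gamma2 E by move=> F /optE0; rewrite succE.
exists E; split=> // F [usdF optF propF].
have E1F := usd_E1_unique gamma1_psd gamma2_psd usdE optE propE usdF optF propF.
have E2F : E_2 E = E_2 F.
  exact: (usd_E1_unique gamma2_psd gamma1_psd
    (is_usd_swap usdE) (optimal_usd_swap optE) (proper_usd_swap propE)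
    (is_usd_swap usdF) (optimal_usd_swap optF) (proper_usd_swap propF)).
(* The inconclusive operators agree because each is the identity minus the other two. *)
by rewrite (usd_eta usdE) (usd_eta usdF) E1F E2F.
Qed.
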